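(* Let $(X,T)$ be a topological dynamical system and $A=(a_{ij})_{1\le i,j\le p}$ a transition matrix, $p\ge2$. Let $T$ be $A$-coupled-expanding in sets $\Lambda_1,\dots,\Lambda_p\subset X$ with $\bigcup_{j=1}^p\Lambda_j=X$ (that is, $T$ is partition-$A$-coupled-expanding). Suppose that: (i) for any $\alpha=(a_0a_1\cdots)\in\Sigma_A^+$, the set $\bigcap_{n=0}^\infty T^{-n}(\Lambda_{a_n})$ is a singleton; (ii) $T(\Lambda_i)=\bigcup_{j:\,a_{ij}=1}\Lambda_j$ for $1\le i\le p$. Then $(\Sigma_A^+,\sigma_A)$ is topologically semi-conjugate to $(X,T)$; that is, the full system $(X,T)$ is a factor of $(\Sigma_A^+,\sigma_A)$.
   Context: A topological dynamical system $(X,T)$ is a compact metric space $X$ together with a surjective continuous map $T:X\to X$. A $p\times p$ matrix $A=(a_{ij})$ is a transition matrix if all $a_{ij}\in\{0,1\}$ and every row sum and every column sum is at least $1$. For $p\ge2$, $T$ is $A$-coupled-expanding in nonempty subsets $\Lambda_1,\dots,\Lambda_p$ of $X$ with pairwise disjoint interiors if $T(\Lambda_i)\supset\bigcup_{j:\,a_{ij}=1}\Lambda_j$ for all $1\le i\le p$. $\Sigma_A^+$ is the space of one-sided sequences $\alpha=(a_0a_1\cdots)$ with $a_n\in\{1,\dots,p\}$ and $(A)_{a_na_{n+1}}=1$ for all $n\ge0$, with the topology induced by the product topology, and $\sigma_A:\Sigma_A^+\to\Sigma_A^+$, $\sigma_A(a_0a_1a_2\cdots)=(a_1a_2\cdots)$,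 is the subshift of finite type. $(X_1,T_1)$ is topologically semi-conjugate to $(X_2,T_2)$, and $(X_2,T_2)$ is called a factor of $(X_1,T_1)$, if there is a continuous surjection $h:X_1\to X_2$ with $h\circ T_1=T_2\circ h$.
   Formalization: The sets Λ_1,…,Λ_p are additionally assumed to be closed; for arbitrary nonempty subsets the claim is false. *)

(* Defs.v *)
From HB Require Import structures.
From mathcomp Require Import all_boot all_order all_algebra.
From mathcomp Require Import all_classical all_reals topology.

Set Implicit Arguments.
Unset Strict Implicit.
Unset Printing Implicit Defensive.

Local Open Scope classical_set_scope.

Definition is_tds (R : realType) (X : metricType R) (T : X -> X) : Prop :=
  [/\ compact [set: X], continuous T & set_surj [set: X] [set: X] T].

Definition transition_matrix (p : nat) (A : 'M[nat]_p) : Prop :=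
  [/\ forall i j, A i j = 0 \/ A i j = 1,
      forall i, 1 <= \sum_(j < p) A i j &
      forall j, 1 <= \sum_(i < p) A i j].

Definition coupled_expanding (X : topologicalType) (T : X -> X) (p : nat)
    (A : 'M[nat]_p) (Lam : 'I_p -> set X) : Prop :=
  [/\ forall i, Lam i !=set0,
      forall i j, i != j -> (Lam i)° `&` (Lam j)° = set0 &
      forall i, \bigcup_(j in [set j | A i j = 1]) Lam j `<=` T @` Lam i].

Definition partition_coupled_expanding (X : topologicalType) (T : X -> X)
    (p : nat) (A : 'M[nat]_p) (Lam : 'I_p -> set X) : Prop :=
  coupled_expanding T A Lam /\ \bigcup_j Lam j = [set: X].

(* Symbols are 'I_p, i.e. 0, ..., p - 1 instead of 1, ..., p.  The type
   [set_type (SigmaA A)] carries the topology induced by the product topology,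
   each factor being discrete. *)
Definition SigmaA (p : nat) (A : 'M[nat]_p) :
    set {ptws nat -> discrete_topology 'I_p} :=
  [set a | forall n, A (a n) (a n.+1) = 1].

Lemma SigmaA_tail (p : nat) (A : 'M[nat]_p) (a : set_type (SigmaA A)) :
  (fun n => set_val a n.+1) \in SigmaA A.
Proof. by apply/mem_set => n; exact: (set_valP a n.+1). Qed.

Definition shiftA (p : nat) (A : 'M[nat]_p) (a : set_type (SigmaA A)) :
    set_type (SigmaA A) :=
  exist _ (fun n => set_val a n.+1) (SigmaA_tail a).

(* (X2, T2) is a factor of (X1, T1). *)
Definition semi_conjugate (X1 : topologicalType) (T1 : X1 -> X1)
    (X2 : topologicalType) (T2 : X2 -> X2) : Prop :=
  exists h : X1 -> X2,
    [/\ continuous h, set_surj [set: X1] [set: X2] h & h \o T1 = T2 \o h].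

(* Main.v *)
Require Import Defs.
From HB Require Import structures.
From mathcomp Require Import all_boot all_order all_algebra.
From mathcomp Require Import all_classical all_reals topology.

(** The factor map [h] sends an admissible sequence [a] to the unique point
    whose orbit visits [Lam (a 0)], [Lam (a 1)], ... in this order.  It commutes
    with the dynamics because dropping the first symbol of an itinerary of [x]
    leaves an itinerary of [T x].

    It is onto because the inclusion of [T (Lam i)] in the union of the [Lam j]
    with [A i j = 1] lets one follow the orbit of any [x] and choose, at each
    step, a set that contains the current point and that the matrix allows after
    the previous one ([admissible_itinerary]); the start is possible since the
    [Lam i] cover [X].

    It is continuous because its graph is closed and [X] is compact
    ([continuous_separated_graph]): if [x <> h a], then some iterate of [x] lies
    outside the closed set [Lam (a n)]; the same [n] works for all points near
    [x] and all sequences near [a], since near [a] the [n]-th symbol is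
    constant ([SigmaA_near_symbol]). *)

Local Open Scope classical_set_scope.

(** The closed graph theorem for a compact codomain.  Compactness of the
    complement of an open neighbourhood of [h a] makes the local separation
    from the graph uniform over that complement. *)
Lemma continuous_separated_graph {Y X : topologicalType} (h : Y -> X) :
  compact [set: X] ->
  (forall a x, x <> h a -> \forall x' \near x & b \near a, x' <> h b) ->
  continuous h.
Proof.
move=> cX sep a U; rewrite nbhsE => -[V [oV Va] VU].
have /compact_near_coveringP cK : compact (~` V).
  by apply: (subclosed_compact _ cX) => //; exact: open_closedC.
have near_sep : \forall b \near a, ~` V `<=` (fun x => x <> h b).
  apply: (cK _ (nbhs a) (fun b x => x <> h b)) => x nVx.
  by apply: sep => xh; apply: nVx; rewrite xh.
apply: filterS near_sep => b sep_b; apply: VU.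
by apply: contrapT => nVhb; exact: sep_b _ nVhb erefl.
Qed.

Lemma continuous_iter {X : topologicalType} (T : X -> X) (n : nat) :
  continuous T -> continuous (iter n T).
Proof.
move=> cT; elim: n => [|n IH] x; first exact: cvg_id.
exact: continuous_comp (IH x) (cT _).
Qed.

Lemma SigmaA_near_symbol {p : nat} {A : 'M[nat]_p} (n : nat)
    (a : set_type (SigmaA A)) :
  \forall b \near a, set_val b n = set_val a n.
Proof.
have val_cvg : set_val @ a --> set_val a by exact: initial_continuous.
have symbol_cvg := @proj_continuous nat (fun=> discrete_topology 'I_p) n
  (set_val a).
exact: val_cvg _ (symbol_cvg _ (discrete_set1 _)).
Qed.

(** The symbols are chosen along the orbit by iterating, on pairs of a symbol
    and a point, a step that applies [T] to the point and picks an allowed next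
    symbol. *)
Lemma admissible_itinerary {X : Type} {T : X -> X} {p : nat} {A : 'M[nat]_p}
    {Lam : 'I_p -> set X} (i : 'I_p) (x : X) :
  (forall i, T @` Lam i `<=` \bigcup_(j in [set j | A i j = 1%N]) Lam j) ->
  Lam i x ->
  exists a : set_type (SigmaA A), forall n, Lam (set_val a n) (iter n T x).
Proof.
move=> img Lix.
have /choice[next nextP] : forall q : 'I_p * X, exists j,
    Lam q.1 q.2 -> A q.1 j = 1%N /\ Lam j (T q.2).
  move=> q; have [Lq|nLq] := pselect (Lam q.1 q.2); last by exists q.1.
  by have [|j Aj Lj] := img q.1 (T q.2); [exists q.2 | exists j].
pose orb n := iter n (fun q => (next q, T q.2)) (i, x).
have orb2 n : (orb n).2 = iter n T x by elim: n => //= n ->.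
have orbL n : Lam (orb n).1 (orb n).2.
  by elim: n => //= n IH; have [] := nextP _ IH.
have aS : (fun n => (orb n).1) \in SigmaA A.
  by apply/mem_set => n; have [] := nextP _ (orbL n).
exists (exist (fun a => a \in SigmaA A) _ aS) => n; rewrite -orb2; exact: orbL.
Qed.

Theorem theorem3 (R : realType) (X : metricType R) (T : X -> X)
  (p : nat) (A : 'M[nat]_p) (Lam : 'I_p -> set X)
  (hT : is_tds T)
  (hp : (2 <= p)%N)
  (hA : transition_matrix A)
  (hLam : forall i, closed (Lam i))
  (hexp : partition_coupled_expanding T A Lam)
  (hsingle : forall a : set_type (SigmaA A), exists x : X,
     \bigcap_n (iter n T @^-1` Lam (set_val a n)) = [set x])
  (himage : forall i, T @` Lam i = \bigcup_(j in [set j | A i j = 1%N]) Lam j) :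
  semi_conjugate (@shiftA p A) T.
Proof.
have [cX cT _] := hT; have [_ cover] := hexp.
have [h hE] := choice hsingle.
have itin a n : Lam (set_val a n) (iter n T (h a)).
  have : [set h a] (h a) by [].
  by rewrite -hE; apply.
have itin_uniq a x : (forall n, Lam (set_val a n) (iter n T x)) -> x = h a.
  move=> Lx; have : [set h a] x by rewrite -hE => n _; exact: Lx.
  by [].
exists h; split.
- apply: continuous_separated_graph => // a x xha.
  have /existsNP[n nLx] : ~ forall n, Lam (set_val a n) (iter n T x).
    by move=> Lx; apply: xha; exact: itin_uniq.
  have near_x : \forall x' \near x, ~ Lam (set_val a n) (iter n T x').
    apply: (continuous_iter T n cT x (~` Lam (set_val a n))).
    by apply: open_nbhs_nbhs; split => //; apply: closed_openC.
  exists ([set x' | ~ Lam (set_val a n) (iter n T x')],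
          [set b | set_val b n = set_val a n]).
    by split => //; exact: SigmaA_near_symbol.
  by move=> [x' b] [/= nLx' ban] x'hb; apply: nLx'; rewrite x'hb -ban.
- move=> x _; have [i _ Lix] : (\bigcup_j Lam j) x by rewrite cover.
  have img j : T @` Lam j `<=` \bigcup_(k in [set k | A j k = 1%N]) Lam k.
    by rewrite himage.
  have [a La] := admissible_itinerary i x img Lix.
  by exists a => //; rewrite -(itin_uniq _ _ La).
- apply/funext => a /=; apply/esym/itin_uniq => n.
  by rewrite -iterSr; exact: itin a n.+1.
Qed.
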